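(* For all $n\geq 3$, $$B_{n}^{neobc}=35B_{n-1}^{neobc}-35B_{n-2}^{neobc}+B_{n-3}^{neobc},\quad C_{n}^{neobc}=35C_{n-1}^{neobc}-35C_{n-2}^{neobc}+C_{n-3}^{neobc},$$ $$R_{n}^{neobc}=35R_{n-1}^{neobc}-35R_{n-2}^{neobc}+R_{n-3}^{neobc},$$ and for all $n\geq 4$, $$CR_{n}^{neobc}=35CR_{n-1}^{neobc}-35CR_{n-2}^{neobc}+CR_{n-3}^{neobc}.$$
   Context: A positive integer $m$ is a neo balcobalancing number if there is a positive integer $r$ (its neo balcobalancer) such that $(1+2+\cdots+(m-1))+(1+2+\cdots+m)=2[(m-1)+m+(m+1)+(m+2)+\cdots+(m+r)]$; then $r=\frac{-2m-1+\sqrt{8m^2-12m+9}}{2}$ (equivalently, $m$ is a neo balcobalancing number iff $8m^2-12m+9$ is a perfect square). For $n\ge1$, $B_n^{neobc}$ denotes the $n$-th neo balcobalancing number in increasing order, $R_n^{neobc}$ its neo balcobalancer, $C_n^{neobc}=\sqrt{8(B_n^{neobc})^2-12B_n^{neobc}+9}$ and $CR_n^{neobc}=\sqrt{2(R_n^{neobc})^2+5R_n^{neobc}+2}$. By convention, $B_0^{neobc}=0$, $R_0^{neobc}=1$, $C_0^{neobc}=CR_0^{neobc}=3$. *)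

(* Defs.v *)
From HB Require Import structures.
From mathcomp Require Import all_boot all_order all_algebra zify.
From mathcomp Require Import boolp classical_sets reals.

Set Implicit Arguments.
Unset Strict Implicit.
Unset Printing Implicit Defensive.

Import Order.TTheory GRing.Theory Num.Theory.

Local Open Scope nat_scope.

(* [m.-1] is the genuine predecessor, since [m] is positive. *)
Definition neo_balcobalancer_of (m r : nat) : Prop :=
  [/\ 0 < m, 0 < r &
      \sum_(1 <= i < m) i + \sum_(1 <= i < m.+1) i
      = 2 * \sum_(m.-1 <= i < (m + r).+1) i].

Definition neo_balcobalancing (m : nat) : Prop :=
  exists r, neo_balcobalancer_of m r.

Lemma sum_iota2 k n : 2 * (\sum_(k <= i < k + n) i) + n = n * (2 * k + n).
Proof.
elim: n => [|n IHn]; first by rewrite addn0 big_geq //; lia.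
rewrite [k + _]addnS big_nat_recr ?leq_addr //=; nia.
Qed.

Lemma neo_balcobalancer_ofE m r :
  neo_balcobalancer_of m r <->
  [/\ 0 < m, 0 < r & m ^ 2 + r + 2 = (r + 2) * (2 * m + r)].
Proof.
rewrite /neo_balcobalancer_of.
case: m => [|m]; first by split=> -[].
have := sum_iota2 1 m; have := sum_iota2 1 m.+1; have := sum_iota2 m (r + 2).
rewrite /= !add1n.
rewrite (_ : m + (r + 2) = (m.+1 + r).+1); last by lia.
by move=> h1 h2 h3; split=> -[? ? ?]; split=> //; nia.
Qed.

(* The step (m, r) |-> (29 m + 12 r - 6, 12 m + 5 r - 4) is the action of the
   unit 17 + 12 sqrt 2 on (4 m - 3)^2 - 2 (2 r + 2 m + 1)^2 = - 9. *)
Lemma neo_balcobalancing_unbounded k :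
  exists m, `[< k < m /\ neo_balcobalancing m >].
Proof.
elim: k => [|k [m /asboolP[ltkm [r]]]].
  exists 6; apply/asboolP; split=> //; exists 1.
  by apply/neo_balcobalancer_ofE.
move=> /neo_balcobalancer_ofE[m0 r0 E]; exists (29 * m + 12 * r - 6).
apply/asboolP; split; first by lia.
exists (12 * m + 5 * r - 4); apply/neo_balcobalancer_ofE; split; nia.
Qed.

Fixpoint Bneobc (n : nat) : nat :=
  if n is n'.+1 then ex_minn (neo_balcobalancing_unbounded (Bneobc n')) else 0.

(* [xget 0] picks the neo balcobalancer, which exists and is unique by the
   lemmas below; the default 0 is never used. *)
Definition Rneobc (n : nat) : nat :=
  if n is 0 then 1 else xget 0 [set r | neo_balcobalancer_of (Bneobc n) r]%classic.

Lemma Bneobc_lt n : Bneobc n < Bneobc n.+1.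
Proof. by rewrite /=; case: ex_minnP => m /asboolP[]. Qed.

Lemma BneobcP n : neo_balcobalancing (Bneobc n.+1).
Proof. by rewrite /=; case: ex_minnP => m /asboolP[]. Qed.

Lemma Bneobc_surj m : neo_balcobalancing m -> exists n, m = Bneobc n.+1.
Proof.
move=> mP; have m0 : Bneobc 0 < m by case: mP => r [].
have ub : forall n, Bneobc n < m -> n <= m.
  suff le n : n <= Bneobc n by move=> n /ltnW; apply: leq_trans.
  by elim: n => // n /leq_ltn_trans; apply; apply: Bneobc_lt.
case: (@ex_maxnP (fun n => Bneobc n < m) m (ex_intro _ 0 m0) ub) => n ltn nmax; exists n.
apply/eqP; rewrite eqn_leq; apply/andP; split.
  by rewrite leqNgt; apply/negP => /nmax; rewrite ltnn.
by rewrite /=; case: ex_minnP => k _; apply; apply/asboolP.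
Qed.

Lemma neo_balcobalancer_of_inj m r s :
  neo_balcobalancer_of m r -> neo_balcobalancer_of m s -> r = s.
Proof.
by move=> /neo_balcobalancer_ofE[? ? ?] /neo_balcobalancer_ofE[? ? ?]; nia.
Qed.

Lemma RneobcP n : neo_balcobalancer_of (Bneobc n.+1) (Rneobc n.+1).
Proof.
by have [r rP] := BneobcP n; rewrite /Rneobc; case: xgetP => [_ _ //|/(_ r)].
Qed.

Local Open Scope ring_scope.

Definition Cneobc (R : realType) (n : nat) : R :=
  if n is 0%N then 3
  else Num.sqrt (8 * (Bneobc n)%:R ^+ 2 - 12 * (Bneobc n)%:R + 9).

Definition CRneobc (R : realType) (n : nat) : R :=
  if n is 0%N then 3
  else Num.sqrt (2 * (Rneobc n)%:R ^+ 2 + 5 * (Rneobc n)%:R + 2).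

(* Main.v *)
Require Import Defs.
From mathcomp Require Import all_boot all_order all_algebra.
From mathcomp Require Import reals.
From mathcomp Require Import boolp zify ring lra.

Import Order.TTheory GRing.Theory Num.Theory.

(** The pairs (m, r) with r > 0 solving the defining quadratic equation are
    (0, 1) together with the neo balcobalancing numbers and their balcobalancers.
    The affine map S (m, r) = (29 m + 12 r - 6, 12 m + 5 r - 4) preserves them,
    and its inverse sends every solution with m > 0 to a smaller solution, so by
    descent S takes each solution to the next one. The map S satisfies
    (S - 1) (S^2 - 34 S + 1) = 0 on affine functions, which is the recurrence for
    B and R, and it transfers to the affine functions C = 2 B + 2 R + 1 and
    CR = B - R - 2. The latter gives -3 instead of 3 at n = 0, which is why
    the recurrence for CR starts at n = 4. *)

Local Open Scope nat_scope.

Definition neo_solution (m r : nat) : Prop :=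
  0 < r /\ m ^ 2 + r + 2 = (r + 2) * (2 * m + r).

Lemma neo_solution_balcobalancer_of m r :
  0 < m -> neo_solution m r <-> neo_balcobalancer_of m r.
Proof.
by move=> m0; rewrite neo_balcobalancer_ofE; split=> [[r0 E]|[_ r0 E]]; split.
Qed.

(** The equation reads [m (m - 2 r - 4) = (r - 1) (r + 2)], whose right side is nonnegative. *)
Lemma neo_solution_lower m r : 0 < m -> neo_solution m r -> r + 2 <= m.
Proof. by move=> m0 [r0 E]; nia. Qed.

(** For [m > 0], [m] is the larger root [r + 2 + sqrt ((2 r + 1) (r + 2))], which increases with
    [r]. *)
Lemma neo_solution_mono m r m' r' :
  neo_solution m r -> neo_solution m' r' -> m <= m' -> r <= r'.
Proof.
move=> sol sol' le; rewrite leqNgt; apply/negP => lt.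
case: (posnP m) => [m0|m0].
  by case: sol sol' => [r0 E] [r'0 E']; subst m; nia.
have lo := neo_solution_lower _ _ m0 sol.
case: sol sol' => [r0 E] [r'0 E'].
have [a Ea] : exists a, m' = m + a by exists (m' - m); lia.
have [b Eb] : exists b, r = r' + b.+1 by exists (r - r').-1; lia.
have [c Ec] : exists c, m = r + 2 + c by exists (m - (r + 2)); lia.
have p x y : 0 <= x * y by [].
move: (p a a) (p a b) (p a c) (p a r') (p b b) (p b c) (p b r').
by subst m' m r; rewrite -!mulnn in E E'; lia.
Qed.

Lemma neo_solution_next m r m' r' : neo_solution m r ->
  m' + 6 = 29 * m + 12 * r -> r' + 4 = 12 * m + 5 * r -> neo_solution m' r'.
Proof.
move=> [r0 E] Em Er; split; first by case: m E Em Er => [|m] E Em Er; nia.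
nia.
Qed.

(** The bound 24 is sharp: [49 * 25 = 35 ^ 2]. *)
Lemma neo_product_nonsquare k t : 0 < k < 24 -> t * t <> (2 * k + 1) * (k + 1).
Proof.
move=> /andP[k0 k24] E.
have t36 : t < 36 by nia.
have chk : all (fun i => all (fun j => j * j != (2 * i + 1) * (i + 1)) (iota 0 36))
               (iota 1 23) by vm_compute.
have /allP/(_ k) := chk; rewrite mem_iota => /(_ ltac:(lia)).
by move=> /allP/(_ t); rewrite mem_iota => /(_ ltac:(lia)); rewrite E eqxx.
Qed.

(* (m - r - 2)^2 = (2 r + 1) (r + 2) forces r = 3 k + 1; dividing by 9
   leaves finitely many k to exclude below r = 73. *)
Lemma neo_solution_gap m r : 0 < m -> neo_solution m r -> r = 1 \/ 73 <= r.
Proof.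
move=> m0 sol; have le := neo_solution_lower _ _ m0 sol; case: sol => r0 E.
have [s Es] : exists s, m = r + 2 + s by exists (m - (r + 2)); lia.
have Esr : s * s = (2 * r + 1) * (r + 2) by subst m; nia.
have [k Ek] : exists k, r = 3 * k + 1.
  (* If [r] is 0 or 2 modulo 3, the product is 2 modulo 3, hence not a square. *)
  exists (r %/ 3); have := divn_eq r 3; have := divn_eq s 3.
  have := @ltn_pmod r 3 isT; have := @ltn_pmod s 3 isT.
  move: (r %/ 3) (s %/ 3) (r %% 3) (s %% 3) => a b c d.
  case: c => [|[|[|c]]] //; case: d => [|[|[|d]]] // _ _ Ess Err;
    subst r s; lia.
have [t Et] : exists t, s = 3 * t.
  exists (s %/ 3); have := divn_eq s 3; have := @ltn_pmod s 3 isT.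
  move: (s %/ 3) (s %% 3) => b d.
  by case: d => [|[|[|d]]] // _ Ess; subst r s; lia.
have Etk : t * t = (2 * k + 1) * (k + 1) by subst r s; nia.
have := @neo_product_nonsquare k t; case: (posnP k) => [|k0]; first by lia.
by case: (ltnP k 24) => [lt /(_ isT)|]; last lia.
Qed.

Lemma neo_solution_prev m' r' : 0 < m' -> neo_solution m' r' ->
  exists m r, [/\ neo_solution m r, m < m', m' + 6 = 29 * m + 12 * r
                & r' + 4 = 12 * m + 5 * r].
Proof.
move=> m0 sol; have le := neo_solution_lower _ _ m0 sol.
have gap := neo_solution_gap _ _ m0 sol; case: sol => r0 E.
have h1 : 12 * r' + 18 <= 5 * m' by nia.
(* This amounts to [r' ^ 2 - 40 r' + 112 > 0], which fails exactly for [4 <= r' <= 36], a range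
   inside the gap. *)
have h2 : 12 * m' < 29 * r' + 44.
  case: gap => [Er|ge]; last by nia.
  by subst r'; nia.
(* The linear part of S has determinant [29 * 5 - 12 * 12 = 1], so S has an integral inverse. *)
exists (5 * m' - (12 * r' + 18)), (29 * r' + 44 - 12 * m').
move: (subnKC h1) (subnKC (ltnW h2)); rewrite -subn_gt0 in h2.
move: (5 * m' - (12 * r' + 18)) (29 * r' + 44 - 12 * m') h2 => m r h2 Em Er.
have E1 : m' + 6 = 29 * m + 12 * r by lia.
have E2 : r' + 4 = 12 * m + 5 * r by lia.
split=> //; [split; [lia|]|lia].
nia.
Qed.

Lemma neo_solution_next_le m r m' r' : neo_solution m r -> neo_solution m' r' ->
  m < m' -> 29 * m + 12 * r <= m' + 6.
Proof.
elim/ltn_ind: m' r' m r => m' IH r' m r sol sol' lt.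
have m'0 : 0 < m' by lia.
have [p [q [solp ltp E1 E2]]] := neo_solution_prev _ _ m'0 sol'.
case: (leqP m p) => [le|ltpm].
  by have := neo_solution_mono _ _ _ _ sol solp le; lia.
(* If [p < m], induction bounds the image of [(p, q)], which is [m'], by [m]: a contradiction. *)
have := IH m lt r p q solp sol ltpm; lia.
Qed.

Lemma neobc_solution n : neo_solution (Bneobc n) (Rneobc n).
Proof.
case: n => [//|n]; have B0 : 0 < Bneobc n.+1 by have := Bneobc_lt n; lia.
by apply/(neo_solution_balcobalancer_of _ _ B0)/RneobcP.
Qed.

Lemma neobc_next n :
  Bneobc n.+1 + 6 = 29 * Bneobc n + 12 * Rneobc n /\
  Rneobc n.+1 + 4 = 12 * Bneobc n + 5 * Rneobc n.
Proof.
have sol := neobc_solution n; have solS := neobc_solution n.+1.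
have lt := Bneobc_lt n.
have leS := neo_solution_next_le _ _ _ _ sol solS lt.
have r0 : 0 < Rneobc n by case: sol.
set m := 29 * Bneobc n + 12 * Rneobc n - 6.
set r := 12 * Bneobc n + 5 * Rneobc n - 4.
have Em : m + 6 = 29 * Bneobc n + 12 * Rneobc n by rewrite /m; lia.
have Er : r + 4 = 12 * Bneobc n + 5 * Rneobc n by rewrite /r; lia.
have solmr := neo_solution_next _ _ _ _ sol Em Er.
have m0 : 0 < m by lia.
(* Minimality in the definition of [Bneobc] gives the bound opposite to [leS]. *)
have le : Bneobc n.+1 <= m.
  rewrite /=; case: ex_minnP => k _; apply; apply/asboolP; split; first by lia.
  by exists r; apply/neo_solution_balcobalancer_of.
have EB : Bneobc n.+1 = m by lia.
have ER : Rneobc n.+1 = r.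
  by apply/eqP; rewrite eqn_leq (neo_solution_mono _ _ _ _ solS solmr)
     ?(neo_solution_mono _ _ _ _ solmr solS) // EB.
by rewrite EB ER.
Qed.

Lemma neobc_lower n : Rneobc n.+1 + 2 <= Bneobc n.+1.
Proof.
apply: neo_solution_lower (neobc_solution _).
by have := Bneobc_lt n; lia.
Qed.

Local Open Scope ring_scope.

(** The equation turns [8 m ^ 2 - 12 m + 9] into [(2 m + 2 r + 1) ^ 2]; the convention at [n = 0]
    fits too. *)
Lemma CneobcE (R : realType) n :
  Cneobc R n = (2 * Bneobc n + 2 * Rneobc n + 1)%:R.
Proof.
case: n => [//|n]; rewrite /Cneobc.
have [_ E] := neobc_solution n.+1.
move: (Bneobc n.+1) (Rneobc n.+1) E => m r E.
have {}E := congr1 (fun k => k%:R : R) E.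
rewrite -[RHS]ger0_norm ?ler0n // -sqrtr_sqr; congr Num.sqrt.
move: E; rewrite !(natrD, natrM, natrX) => E; lra.
Qed.

Lemma CRneobcE (R : realType) n :
  CRneobc R n.+1 = (Bneobc n.+1)%:R - (Rneobc n.+1)%:R - 2.
Proof.
rewrite /CRneobc; have [_ E] := neobc_solution n.+1.
have le : (Rneobc n.+1)%:R + 2 <= (Bneobc n.+1)%:R :> R.
  by rewrite -natrD ler_nat neobc_lower.
move: (Bneobc n.+1) (Rneobc n.+1) E le => m r E le.
have {}E := congr1 (fun k => k%:R : R) E.
(* The radicand is [(m - r - 2) ^ 2], and [le] fixes the sign of its root. *)
rewrite -[RHS]ger0_norm; last by rewrite -addrA -opprD subr_ge0.
rewrite -sqrtr_sqr; congr Num.sqrt.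
move: E; rewrite !(natrD, natrM, natrX) => E; lra.
Qed.

Lemma neobc_next_ring (A : pzRingType) n :
  (Bneobc n.+1)%:R = 29 * (Bneobc n)%:R + 12 * (Rneobc n)%:R - 6 :> A /\
  (Rneobc n.+1)%:R = 12 * (Bneobc n)%:R + 5 * (Rneobc n)%:R - 4 :> A.
Proof.
have [EB ER] := neobc_next n.
by rewrite -!natrM -!natrD -EB -ER !natrD !addrK.
Qed.

Theorem theorem3p2 (R : realType) :
  (forall n : nat, (3 <= n)%N ->
     [/\ (Bneobc n)%:Z = 35 * (Bneobc (n - 1))%:Z - 35 * (Bneobc (n - 2))%:Z
                         + (Bneobc (n - 3))%:Z,
         Cneobc R n = 35 * Cneobc R (n - 1) - 35 * Cneobc R (n - 2)
                      + Cneobc R (n - 3)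
       & (Rneobc n)%:Z = 35 * (Rneobc (n - 1))%:Z - 35 * (Rneobc (n - 2))%:Z
                         + (Rneobc (n - 3))%:Z]) /\
  (forall n : nat, (4 <= n)%N ->
     CRneobc R n = 35 * CRneobc R (n - 1) - 35 * CRneobc R (n - 2)
                   + CRneobc R (n - 3)).
Proof.
have rec (A : comPzRingType) n :
    (Bneobc n.+3)%:R = 35 * (Bneobc n.+2)%:R - 35 * (Bneobc n.+1)%:R
                       + (Bneobc n)%:R :> A /\
    (Rneobc n.+3)%:R = 35 * (Rneobc n.+2)%:R - 35 * (Rneobc n.+1)%:R
                       + (Rneobc n)%:R :> A.
  have [-> ->] := neobc_next_ring A n.+2; have [-> ->] := neobc_next_ring A n.+1.
  by have [-> ->] := neobc_next_ring A n; split; ring.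
split=> [[|[|[|n]]] // _|[|[|[|[|n]]]] // _]; rewrite !subSS !subn0.
  have [HB HR] := rec int n; have [HB' HR'] := rec R n.
  rewrite -!natz; split=> //.
  (* The constant term survives because [35 - 35 + 1 = 1]. *)
  by rewrite !CneobcE !(natrD, natrM) HB' HR'; ring.
have [HB HR] := rec R n.+1.
by rewrite !CRneobcE HB HR; ring.
Qed.
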